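(* For every finite set $A$ of positive reals and every integer $\ell\ge0$, \[F_\ell(A;t)=\big(F_1(A;t)\big)^{\ell}\] as formal power series, where $F_\ell(A;t)=\sum_{n\ge0} r_\ell(\mathcal{C}_{n,A})\frac{t^n}{n!}$.
   Context: Let $A=\{a_1,\dots,a_m\}$ with $a_1>\dots>a_m>0$. For $n\ge1$, $\mathcal{C}_{n,A}$ is the arrangement in $\mathbb{R}^n$ of hyperplanes $x_i-x_j=0$ ($i<j$) and $x_i-x_j=a_k$ ($i\ne j$, $1\le k\le m$). Regions are connected components of the complement of the union of the hyperplanes. The level of $X\subseteq\mathbb{R}^n$ is the smallest integer $\ell\ge0$ such that there are a linear subspace $W$ of dimension $\ell$ and $r>0$ with $X\subseteq\{\bm x:\min_{\bm y\in W}\|\bm x-\bm y\|\le r\}$. $r_\ell(\mathcal{A})$ is the number of regions of $\mathcal{A}$ of level $\ell$. Convention: for $n=0$ there is exactly one region, of level $0$. *)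

(* Defs.v *)
From HB Require Import structures.
From mathcomp Require Import all_boot all_order all_algebra.
From mathcomp Require Import finmap.
From mathcomp Require Import all_classical all_reals.
From mathcomp Require Import topology normedtype matrix_topology matrix_normedtype.
Unset Printing Implicit Defensive.
Import Order.TTheory GRing.Theory Num.Theory numFieldTopology.Exports numFieldNormedType.Exports.
Local Open Scope classical_set_scope.
Local Open Scope ring_scope.

Section Defs.
Variable R : realType.

Definition CnA_union (A : seq R) (n : nat) : set 'rV[R]_n :=
  [set x | (exists i j : 'I_n, (i < j)%N /\ x ord0 i - x ord0 j = 0) \/
           (exists i j : 'I_n, exists2 a, a \in A & i != j /\ x ord0 i - x ord0 j = a)].

Definition regions (A : seq R) (n : nat) : set (set 'rV[R]_n) :=
  [set @connected_component _ (~` CnA_union A n) x | x in ~` CnA_union A n].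

Definition near_subspace (n l : nat) (X : set 'rV[R]_n) : Prop :=
  exists B : 'M[R]_(l, n), \rank B = l /\
    exists2 r : R, 0 < r &
      forall x, X x -> exists y : 'rV[R]_n, (y <= B)%MS /\
        Num.sqrt (\sum_(i < n) (x ord0 i - y ord0 i) ^+ 2) <= r.

Definition is_level (n l : nat) (X : set 'rV[R]_n) : Prop :=
  near_subspace n l X /\ forall k, (k < l)%N -> ~ near_subspace n k X.

Definition r_level (A : seq R) (l n : nat) : nat :=
  #|` fset_set [set X | regions A n X /\ is_level n l X] |.

Definition F_trunc (A : seq R) (l N : nat) : {poly R} :=
  \poly_(k < N.+1) ((r_level A l k)%:R / (k`!)%:R).

End Defs.

(* Main.v *)
(** A region is determined by the signs of all [x_i - x_j - a] with [i <> j] and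
    [a] in [A] or [a = 0].  Let [M] be the largest element of [A] ([0] if [A] is
    empty).  Sorted by coordinate, the indices of a point fall into blocks
    separated by gaps larger than [M], and the level of the region is the number
    of blocks: inside a region the coordinates of a block stay at bounded
    distance from each other, whereas all the coordinates below a gap may be
    pushed down arbitrarily far.  A block is represented by its largest element,
    a "leader": an index [j] such that no [x_i] lies strictly between [x_j] and
    [x_j + M].

    Cutting off the top block identifies a region of level [l + 1] with a set of
    indices, a region of level 1 on it, and a region of level [l] on its
    complement, hence [F_(l + 1) = F_1 F_l]. *)

Require Import Defs.
From HB Require Import structures.
From mathcomp Require Import all_boot all_order all_algebra finmap.
From mathcomp Require Import all_classical all_reals.
From mathcomp Require Import topology normedtype matrix_topology matrix_normedtype.
From mathcomp Require Import ring lra.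
Import Order.TTheory GRing.Theory Num.Theory.
Import numFieldTopology.Exports numFieldNormedType.Exports.
Local Open Scope ring_scope.

Lemma same_side_convex (R : realType) (v p q t : R) : 0 <= t <= 1 ->
  (p < v) = (q < v) -> p != v -> q != v -> (1 - t) * p + t * q != v.
Proof.
move=> /andP[t0 t1] pq pv qv; have [->|tn0] := eqVneq t 0.
  by rewrite subr0 mul1r mul0r addr0.
have {}t0 : 0 < t by rewrite lt_neqAle eq_sym tn0.
have {}t1 : 0 <= 1 - t by rewrite subr_ge0.
move: pv; rewrite neq_lt => /orP[pv|vp].
  have : 0 <= (1 - t) * (v - p) by rewrite mulr_ge0 // subr_ge0 ltW.
  have : 0 < t * (v - q) by rewrite mulr_gt0 // subr_gt0 -pq.
  by move=> ? ?; rewrite lt_eqF //; lra.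
have : 0 <= (1 - t) * (p - v) by rewrite mulr_ge0 // subr_ge0 ltW.
have : 0 < t * (q - v).
  by rewrite mulr_gt0 // subr_gt0 lt_neqAle eq_sym qv leNgt -pq -leNgt ltW.
by move=> ? ?; rewrite gt_eqF //; lra.
Qed.

(** * Sign vectors and leaders *)

Section Signs.
Set Implicit Arguments. Unset Strict Implicit.
Variables (R : realType) (K : finType) (w : K -> R) (k0 kM : K).
(* [w] enumerates the thresholds [0 :: A]; [k0] and [kM] index its minimum [0]
   and its maximum. *)
Hypotheses (w0 : w k0 = 0) (w_ge0 : forall k, 0 <= w k).
Hypothesis w_leM : forall k, w k <= w kM.

(** Points are functions on an arbitrary finite type, so that they can be restricted to a set of
    indices and to its complement. *)
Definition generic (T : finType) (x : T -> R) : Prop :=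
  forall i j k, i != j -> x i - x j != w k.

Definition sgn (T : finType) (x : T -> R) : {ffun T * T * K -> bool} :=
  [ffun p => x p.1.1 - x p.1.2 < w p.2].

(* On [sgn x], the two tests say [x j < x i] and [x i < x j + w kM]. *)
Definition leaders (T : finType) (s : {ffun T * T * K -> bool}) : {set T} :=
  [set j | [forall i, ~~ (s (j, i, k0) && s (i, j, kM))]].

Definition realized (T : finType) (s : {ffun T * T * K -> bool}) : bool :=
  `[< exists2 x, generic x & sgn x = s >].

(** A finite model of the regions of level [l], in which they can be counted; [card_cells] makes the
    comparison. *)
Definition Reg (T : finType) (l : nat) : {set {ffun T * T * K -> bool}} :=
  [set s | realized s & #|leaders s| == l].

Definition above (T : finType) (s : {ffun T * T * K -> bool}) (i : T) : {set T} :=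
  [set j in leaders s | ~~ s (j, i, k0)].

(* [above (sgn x) i] has one element per block at or above that of [i]. *)
Definition top (T : finType) (s : {ffun T * T * K -> bool}) : {set T} :=
  [set i | #|above s i| == 1%N].

Definition pull (T T' : finType) (h : T' -> T) (s : {ffun T * T * K -> bool}) :
    {ffun T' * T' * K -> bool} :=
  [ffun p => s (h p.1.1, h p.1.2, p.2)].

Lemma sgnE (T : finType) (x : T -> R) i j k : sgn x (i, j, k) = (x i - x j < w k).
Proof. by rewrite ffunE. Qed.

Lemma sgn0E (T : finType) (x : T -> R) i j : sgn x (i, j, k0) = (x i < x j).
Proof. by rewrite sgnE w0 subr_lt0. Qed.

Lemma sgn_pull (T T' : finType) (h : T' -> T) (x : T -> R) :
  pull h (sgn x) = sgn (x \o h).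
Proof. by apply/ffunP => p; rewrite !ffunE. Qed.

Lemma generic_pull (T T' : finType) (h : T' -> T) (x : T -> R) :
  injective h -> generic x -> generic (x \o h).
Proof. by move=> hi gx i j k ij; apply: gx; rewrite (inj_eq hi). Qed.

Lemma generic_inj (T : finType) (x : T -> R) : generic x -> injective x.
Proof.
move=> gx i j xij; apply/eqP/negPn/negP => ij.
by have := gx i j k0 ij; rewrite w0 xij subrr eqxx.
Qed.

Lemma leadersP (T : finType) (x : T -> R) j :
  reflect (forall i, x j < x i -> x j + w kM <= x i) (j \in leaders (sgn x)).
Proof.
rewrite inE; apply: (iffP forallP) => H i.
  by move=> ji; have := H i; rewrite sgn0E sgnE ji /= -leNgt lerBrDl.
rewrite sgn0E sgnE; apply/negP => /andP[/H ji].
by rewrite ltrBlDl ltNge ji.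
Qed.

Lemma RegP (T : finType) l s :
  reflect (exists x, [/\ generic x, sgn x = s & #|leaders (sgn x)| = l])
    (s \in Reg T l).
Proof.
rewrite inE; apply: (iffP andP) => [[/asboolP[x gx <-] /eqP]|[x [gx <- <-]]].
  by exists x.
by split=> //; apply/asboolP; exists x.
Qed.

Lemma Reg_sgn (T : finType) l (x : T -> R) : generic x -> #|leaders (sgn x)| = l ->
  sgn x \in Reg T l.
Proof. by move=> gx <-; apply/RegP; exists x. Qed.

Lemma aboveE (T : finType) (x : T -> R) i j :
  (j \in above (sgn x) i) = (j \in leaders (sgn x)) && (x i <= x j).
Proof. by rewrite [LHS]inE sgn0E -leNgt. Qed.

Lemma above_max (T : finType) (x : T -> R) i : exists2 m, m \in above (sgn x) i &
  forall j, x j <= x m.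
Proof.
have [m _ mP] := @Order.TotalTheory.arg_maxP _ _ T i xpredT x isT.
have mle j : x j <= x m by apply: mP.
exists m => //; rewrite aboveE mle andbT; apply/leadersP => j.
by rewrite ltNge mle.
Qed.

(** Let [m] be the only leader at or above [i]. If [j] were not below [i], its only leader would be
    [m] too; so [j] is below [i] and has another leader [k]. Then [k] is also below [i], and the gap
    above [k] separates [j] from [i]. *)
Lemma top_split (T : finType) (x : T -> R) : generic x ->
  forall i j, i \in top (sgn x) -> j \notin top (sgn x) -> x j + w kM < x i.
Proof.
move=> gx i j; rewrite !inE => /cards1P[m iE] jn1.
have [[p pj _] [q qi _]] := (above_max x j, above_max x i).
have mi : m \in above (sgn x) i by rewrite iE inE.
have ltji : x j < x i.
  rewrite ltNge; apply: contra jn1 => ij; apply/cards1P; exists m.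
  apply/setP => k; rewrite inE; apply/idP/eqP => [|->].
    rewrite aboveE => /andP[kl jk]; apply/finset.set1P; rewrite -iE aboveE kl.
    exact: le_trans jk.
  have : p \in above (sgn x) i.
    move: pj; rewrite !aboveE => /andP[-> jp]; exact: le_trans jp.
  by rewrite iE inE => /eqP <-.
have mj : m \in above (sgn x) j.
  by move: mi; rewrite !aboveE => /andP[-> /=]; apply/le_trans/ltW.
have [k kj km] : exists2 k, k \in above (sgn x) j & k != m.
  apply/exists_inP; apply: contraR jn1 => /exists_inPn H; apply/cards1P.
  exists m; apply/setP => k; rewrite inE; apply/idP/eqP => [/H|-> //].
  by rewrite negbK => /eqP.
move: kj; rewrite aboveE => /andP[kl jk].
have ki : x k < x i.
  rewrite ltNge; apply: contra km => ik.
  by rewrite -finset.in_set1 -iE aboveE kl.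
(* The leader condition gives only a weak inequality; equality would contradict genericity at the
   threshold [w kM]. *)
have := leadersP _ _ kl _ ki.
rewrite le_eqVlt => /predU1P[E|]; last by apply: le_lt_trans; rewrite lerD2r.
have ik : i != k by apply: contraTneq ki => ->; rewrite ltxx.
by have := gx _ _ kM ik; rewrite -E addrAC subrr add0r eqxx.
Qed.

(** * Cutting the indices at a gap *)

Section Split.
Variables (T : finType) (x : T -> R) (S : {set T}).
Hypothesis gx : generic x.
Hypothesis xS : forall i j, i \in S -> j \notin S -> x j + w kM < x i.

Let xS_lt i j : i \in S -> j \notin S -> x j < x i.
Proof. by move=> iS /(xS iS); apply: le_lt_trans; rewrite lerDl. Qed.

Lemma leaders_split_in (i : {i | i \in S}) :
  (val i \in leaders (sgn x)) = (i \in leaders (sgn (x \o val))).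
Proof.
apply/leadersP/leadersP => H j; first exact: H.
case: (boolP (j \in S)) => jS; first exact: (H (Sub j jS)).
by rewrite ltNge (ltW (xS_lt (valP i) jS)).
Qed.

(** Indices of [S] lie more than [w kM] above the others, so they pass the leader test
    automatically. *)
Lemma leaders_split_out (i : {i | i \in ~: S}) :
  (val i \in leaders (sgn x)) = (i \in leaders (sgn (x \o val))).
Proof.
apply/leadersP/leadersP => H j; first exact: H.
case: (boolP (j \in ~: S)) => jS; first exact: (H (Sub j jS)).
rewrite inE negbK in jS; move=> _; apply/ltW/xS => //.
by have := valP i; rewrite inE.
Qed.

Lemma card_leaders_in :
  #|leaders (sgn x) :&: S| =
  #|leaders (sgn (x \o (val : {i | i \in S} -> T)))|.
Proof.
rewrite -(card_imset _ val_inj); apply: eq_card => i.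
rewrite inE; apply/andP/imsetP => [[il iS]|[u ul ->]].
  by exists (Sub i iS) => //; rewrite -leaders_split_in.
by rewrite leaders_split_in (valP u).
Qed.

Lemma card_leaders_out :
  #|leaders (sgn x) :\: S| =
  #|leaders (sgn (x \o (val : {i | i \in ~: S} -> T)))|.
Proof.
rewrite finset.setDE -(card_imset _ val_inj); apply: eq_card => i.
rewrite inE; apply/andP/imsetP => [[il iS]|[u ul ->]].
  by exists (Sub i iS) => //; rewrite -leaders_split_out.
by rewrite leaders_split_out (valP u).
Qed.

(** Converse of [top_split]: an index of [S] has only the leader [m] of [S] above it, an index
    outside has both [m] and a leader of the complement. *)
Lemma top_splitE :
  #|leaders (sgn (x \o (val : {i | i \in S} -> T)))| = 1%N ->
  top (sgn x) = S.
Proof.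
rewrite -card_leaders_in => /eqP/cards1P[m mE].
have /finset.setIP[ml mS] : m \in leaders (sgn x) :&: S by rewrite mE inE.
have Sm i : i \in S -> x i <= x m.
  move=> iS; have [q] := above_max x i; rewrite aboveE => /andP[ql iq] qmax.
  suff -> : m = q by [].
  apply/esym/eqP; rewrite -finset.in_set1 -mE inE ql; apply/negPn/negP => qS.
  by have := xS_lt mS qS; rewrite ltNge qmax.
apply/setP => i; rewrite inE; case: (boolP (i \in S)) => iS.
  apply/cards1P; exists m; apply/setP => j; rewrite aboveE inE.
  apply/andP/eqP => [[jl ij]|->]; last by split=> //; exact: Sm.
  apply/eqP; rewrite -finset.in_set1 -mE inE jl; apply/negPn/negP => jS.
  by have := xS_lt iS jS; rewrite ltNge ij.
have iS' : i \in ~: S by rewrite inE.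
have [q] := above_max (x \o (val : {i | i \in ~: S} -> T)) (Sub i iS').
rewrite aboveE /= => /andP[]; rewrite -leaders_split_out => ql iq _.
apply/negbTE/cards1P => -[p pE].
have : val q \in above (sgn x) i by rewrite aboveE ql.
have : m \in above (sgn x) i by rewrite aboveE ml ltW ?xS_lt.
rewrite pE !inE => /eqP <- /eqP qp.
by have := valP q; rewrite inE qp; have := mS; case: (_ \in _).
Qed.

End Split.

(** The leader with the largest coordinate lies in [top]; any other leader has both itself and that
    one above it. *)
Lemma card_leaders_top (T : finType) (x : T -> R) l : generic x ->
  #|leaders (sgn x)| = l.+1 -> #|leaders (sgn x) :&: top (sgn x)| = 1%N.
Proof.
move=> gx lx.
have [i il] : exists i, i \in leaders (sgn x) by apply/card_gt0P; rewrite lx.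
have [m] := above_max x i; rewrite aboveE => /andP[ml im] mmax.
apply/eqP/cards1P; exists m; apply/setP => j.
rewrite finset.in_setI [_ \in top _]inE [_ \in [set m]]inE.
have mT : above (sgn x) m = [set m].
  apply/setP => k; rewrite aboveE inE; apply/andP/eqP => [[_ mk]|->//].
  by apply: (generic_inj gx); apply/le_anti; rewrite mmax.
apply/andP/eqP => [[jl /cards1P[p pE]]|->]; last first.
  by rewrite ml mT cards1.
have : j \in above (sgn x) j by rewrite aboveE jl lexx.
have : m \in above (sgn x) j by rewrite aboveE ml mmax.
by rewrite pE !inE => /eqP -> /eqP ->.
Qed.

(** * Counting regions by their top block *)

Lemma exists_glue (T : finType) (S : {set T}) (x1 : {i | i \in S} -> R)
    (x2 : {i | i \in ~: S} -> R) : generic x1 -> generic x2 ->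
  exists x : T -> R, [/\ generic x,
    forall i j, i \in S -> j \notin S -> x j + w kM < x i,
    sgn (x \o val) = sgn x1 & sgn (x \o val) = sgn x2].
Proof.
move=> g1 g2.
(* The shift [C] exceeds [w kM] plus any difference [x2 j - x1 i], which lifts [S] above its
   complement with a gap. *)
pose C : R := \sum_i `|x1 i| + \sum_i `|x2 i| + w kM + 1.
pose x (i : T) : R := if insub i is Some u then x1 u + C else
  if insub i is Some v then x2 v else 0.
have xin (u : {i | i \in S}) : x (val u) = x1 u + C by rewrite /x valK.
have xout (u : {i | i \in ~: S}) : x (val u) = x2 u.
  by rewrite /x insubF ?valK //; apply/negbTE; have := valP u; rewrite inE.
have b1 u : `|x1 u| <= \sum_i `|x1 i|.
  by rewrite (bigD1 u) //= lerDl sumr_ge0.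
have b2 u : `|x2 u| <= \sum_i `|x2 i|.
  by rewrite (bigD1 u) //= lerDl sumr_ge0.
have xS i j : i \in S -> j \notin S -> x j + w kM < x i.
  move=> iS; rewrite -finset.in_setC => jS.
  rewrite -[i]/(val (Sub i iS : {i | i \in S})).
  rewrite -[j]/(val (Sub j jS : {i | i \in ~: S})).
  rewrite xin xout /C.
  have := b1 (Sub i iS); have := b2 (Sub j jS).
  by rewrite !ler_norml => /andP[] ? ? /andP[] ? ?; lra.
exists x; split=> //.
- move=> i j k ij.
  case: (boolP (i \in S)) => iS; case: (boolP (j \in S)) => jS.
  + rewrite -[i]/(val (Sub i iS : {i | i \in S})).
    rewrite -[j]/(val (Sub j jS : {i | i \in S})) !xin.
    by rewrite opprD addrACA subrr addr0; apply: g1.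
  + have := xS _ _ iS jS; have := w_leM k => ? ?.
    by rewrite gt_eqF //; lra.
  + have := xS _ _ jS iS; have := w_leM k; have := w_ge0 k => ? ? ?.
    by rewrite lt_eqF //; lra.
  + rewrite -finset.in_setC in iS; rewrite -finset.in_setC in jS.
    rewrite -[i]/(val (Sub i iS : {i | i \in ~: S})).
    rewrite -[j]/(val (Sub j jS : {i | i \in ~: S})) !xout.
    exact: g2.
- by apply/ffunP => p; rewrite !ffunE /= !xin opprD addrACA subrr addr0.
- by apply/ffunP => p; rewrite !ffunE /= !xout.
Qed.

(** Signs of pairs straddling [S] are forced by the gap, as all thresholds lie between 0 and
    [w kM]. *)
Lemma sgn_split_inj (T : finType) (S : {set T}) (x y : T -> R) :
  (forall i j, i \in S -> j \notin S -> x j + w kM < x i) ->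
  (forall i j, i \in S -> j \notin S -> y j + w kM < y i) ->
  pull (val : {i | i \in S} -> T) (sgn x) = pull val (sgn y) ->
  pull (val : {i | i \in ~: S} -> T) (sgn x) = pull val (sgn y) ->
  sgn x = sgn y.
Proof.
move=> xS yS /ffunP e1 /ffunP e2; apply/ffunP => -[[i j] k].
case: (boolP (i \in S)) => iS; case: (boolP (j \in S)) => jS.
- by have := e1 (Sub i iS, Sub j jS, k); rewrite !ffunE.
- have := xS _ _ iS jS; have := yS _ _ iS jS; have := w_leM k.
  rewrite !sgnE => ? ? ?.
  by rewrite !ltNge; congr (~~ _); apply/idP/idP => _; lra.
- have := xS _ _ jS iS; have := yS _ _ jS iS; have := w_leM k.
  have := w_ge0 k; rewrite !sgnE => ? ? ? ?.
  by apply/idP/idP => _; lra.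
- rewrite -finset.in_setC in iS; rewrite -finset.in_setC in jS.
  by have := e2 (Sub i iS, Sub j jS, k); rewrite !ffunE.
Qed.

(** Restriction to [S] and to its complement is a bijection: [sgn_split_inj] gives injectivity,
    [exists_glue] a preimage. *)
Lemma card_Reg_top (T : finType) l (S : {set T}) :
  #|[set s in Reg T l.+1 | top s == S]| =
  (#|Reg {i | i \in S} 1| * #|Reg {i | i \in ~: S} l|)%N.
Proof.
rewrite -cardsX.
pose f (s : {ffun T * T * K -> bool}) :=
  (pull (val : {i | i \in S} -> T) s, pull (val : {i | i \in ~: S} -> T) s).
rewrite -(@card_in_imset _ _ f); last first.
  move=> s s'; rewrite !inE => /andP[/andP[/asboolP[x gx <-] _] /eqP xE].
  move=> /andP[/andP[/asboolP[y gy <-] _] /eqP yE] [e1 e2].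
  by apply: sgn_split_inj e1 e2; [rewrite -xE|rewrite -yE]; apply: top_split.
apply: eq_card => -[s1 s2]; apply/imsetP/setXP => /=.
  case=> s; rewrite inE => /andP[/RegP[x [gx <- lx]] /eqP xE] [-> ->].
  have xS := top_split gx; rewrite xE in xS.
  have c1 := card_leaders_top gx lx.
  rewrite xE in c1.
  rewrite !sgn_pull; split; (apply: Reg_sgn; first exact: (generic_pull val_inj)).
    by rewrite -card_leaders_in.
  rewrite -card_leaders_out //.
  by have := cardsID S (leaders (sgn x)); rewrite c1 lx add1n => -[].
case=> /RegP[x1 [g1 <- l1]] /RegP[x2 [g2 <- l2]].
have [x [gx xS e1 e2]] := exists_glue g1 g2.
exists (sgn x); last by rewrite /f !sgn_pull e1 e2.
have xE : top (sgn x) = S by apply: top_splitE => //; rewrite e1.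
rewrite inE xE eqxx andbT Reg_sgn //.
by rewrite -(cardsID S) (card_leaders_in xS) (card_leaders_out xS) e1 e2 l1 l2.
Qed.

Lemma leq_card_Reg (T T' : finType) l (h : T' -> T) : bijective h ->
  (#|Reg T l| <= #|Reg T' l|)%N.
Proof.
move=> hb; have hi := bij_inj hb.
rewrite -(@card_in_imset _ _ (pull h)); last first.
  move=> s s' _ _ /ffunP e; apply/ffunP => -[[i j] k].
  have [g _ gK] := hb.
  by have := e (g i, g j, k); rewrite !ffunE /= !gK.
apply/subset_leq_card/fintype.subsetP => _ /imsetP[_ /RegP[x [gx <- lx]] ->].
rewrite sgn_pull; apply: Reg_sgn; first exact: generic_pull.
rewrite -{}lx -[RHS](@on_card_preimset _ _ h); last first.
  by apply: onW_bij.
apply: eq_card => j; rewrite [RHS]inE; apply/leadersP/leadersP => H i; last exact: H.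
by have [g _ gK] := hb; rewrite -[i]gK; apply: H.
Qed.

Lemma card_Reg_eq (T T' : finType) l : #|T| = #|T'| -> #|Reg T l| = #|Reg T' l|.
Proof.
move=> e; apply/eqP; rewrite eqn_leq; apply/andP; split.
  apply: (@leq_card_Reg _ _ _ (fun j => enum_val (cast_ord (esym e) (enum_rank j)))).
  apply: inj_card_bij; last by rewrite e.
  by move=> i j /enum_val_inj/cast_ord_inj/enum_rank_inj.
apply: (@leq_card_Reg _ _ _ (fun j => enum_val (cast_ord e (enum_rank j)))).
apply: inj_card_bij; last by rewrite e.
by move=> i j /enum_val_inj/cast_ord_inj/enum_rank_inj.
Qed.

Lemma card_Reg_rec n l : #|Reg 'I_n l.+1| =
  (\sum_(k < n.+1) 'C(n, k) * (#|Reg 'I_k 1| * #|Reg 'I_(n - k) l|))%N.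
Proof.
rewrite -sum1_card (partition_big (@top 'I_n) xpredT) //=.
transitivity (\sum_(S : {set 'I_n}) #|Reg 'I_#|S| 1| * #|Reg 'I_(n - #|S|) l|)%N.
  apply: eq_bigr => S _.
  have <- : #|[set s in Reg 'I_n l.+1 | top s == S]| = 
    (\sum_(s in Reg 'I_n l.+1 | top s == S) 1)%N.
    by rewrite -sum1_card; apply: eq_bigl => s; rewrite inE.
  rewrite card_Reg_top; congr (_ * _)%N; apply: card_Reg_eq.
    by rewrite card_sig card_ord.
  rewrite card_sig card_ord; transitivity #|~: S|; first exact: eq_card.
  by rewrite -(addKn #|S| #|~: S|) cardsC card_ord.
rewrite (partition_big (fun S : {set 'I_n} => inord #|S| : 'I_n.+1) xpredT) //=.
apply: eq_bigr => k _; 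
have <- : #|[set S : {set 'I_n} | #|S| == k]| = 'C(n, k).
  by rewrite card_draws card_ord.
rewrite -sum1_card big_distrl /=.
have Sn (S : {set 'I_n}) : (#|S| < n.+1)%N.
  by rewrite ltnS -[X in (_ <= X)%N]card_ord max_card.
apply: eq_big => [S|S /eqP <-]; last by rewrite mul1n inordK.
by rewrite inE -val_eqE /= inordK.
Qed.

Lemma card_Reg0 n : #|Reg 'I_n 0| = (n == 0)%N.
Proof.
case: n => [|n]; last first.
  apply: eq_card0 => s; apply/RegP => -[x [_ _ /eqP]].
  have [m + _] := above_max x ord0; rewrite aboveE => /andP[+ _].
  by rewrite cards_eq0 => + /eqP E; rewrite E inE.
have x : 'I_0 -> R by case.
transitivity #|[set sgn x]|; last by rewrite cards1.
apply: eq_card => s; apply/idP/finset.set1P => [_|->].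
  by apply/ffunP => -[[[]]].
by apply: Reg_sgn; [case | apply: eq_card0; case].
Qed.

(** * Level of a region *)

(* The directions exhibited here span a space of dimension the number of
   leaders, which bounds the level from below. *)
Lemma shift_down (T : finType) (x : T -> R) (j : T) (t : R) :
  generic x -> j \in leaders (sgn x) -> 0 <= t ->
  let z := fun i => x i - t * (x i <= x j)%R%:R in
  generic z /\ sgn z = sgn x.
Proof.
move=> gx /leadersP jl t0 z.
have up i i' : x j < x i -> x i' <= x j -> x i' + w kM < x i.
  move=> ji i'j; rewrite lt_neqAle; apply/andP; split; last first.
    by apply: le_trans (jl _ ji); rewrite lerD2r.
  have ii' : i != i' by apply: contraTneq (le_lt_trans i'j ji) => ->; rewrite ltxx.
  by apply: contra (gx i i' kM ii') => /eqP <-; rewrite addrAC subrr add0r.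
(* The shift preserves a difference, enlarges one already above [w kM], or lowers one already
   negative; no threshold is crossed. *)
have zx i i' : [\/ z i - z i' = x i - x i',
    w kM < x i - x i' /\ w kM < z i - z i' |
    x i - x i' < 0 /\ z i - z i' < 0].
  rewrite /z; have [ij|ij] := leP (x i) (x j); have [i'j|i'j] := leP (x i') (x j).
  all: rewrite ?mulr1 ?mulr0 ?subr0.
  - by apply: Or31; rewrite opprB addrA subrK.
  - apply: Or33; have := up _ _ i'j ij; have := w_ge0 kM => ? ?.
    by split; lra.
  - by apply: Or32; have := up _ _ ij i'j => ?; split; lra.
  - exact: Or31.
split.
  move=> i i' k ii'; case: (zx i i') => [->|[_ zM]|[_ zl]]; first exact: gx.
    by rewrite gt_eqF // (le_lt_trans (w_leM k)).
  by rewrite lt_eqF // (lt_le_trans zl).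
apply/ffunP => -[[i i'] k]; rewrite !ffunE /=.
case: (zx i i') => [->//|[xM zM]|[xl zl]].
  by rewrite !ltNge !ltW // (le_lt_trans (w_leM k)).
by rewrite !(lt_le_trans _ (w_ge0 k)).
Qed.

(** A non-leader has another index less than [w kM] above it; climbing ends at a leader. Each step
    reads only signs, so one chain serves every [y] with the same sign vector. *)
Lemma leader_chain (T : finType) (x : T -> R) (i : T) :
  exists j, [/\ j \in leaders (sgn x), i \in leaders (sgn x) -> j = i &
    forall y : T -> R, sgn y = sgn x -> `|y i - y j| <= #|T|%:R * w kM].
Proof.
suff [j [jl ji jy]] : exists j, [/\ j \in leaders (sgn x),
    i \in leaders (sgn x) -> j = i & forall y : T -> R, sgn y = sgn x ->
    y i <= y j <= y i + #|[set k | x i < x k]|%:R * w kM].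
  exists j; split=> // y /jy /andP[yij yji].
  rewrite distrC ger0_norm ?subr_ge0 // lerBlDl (le_trans yji) // lerD2l.
  by rewrite ler_wpM2r // ler_nat max_card.
(* Induction on a bound for the number of indices strictly above [i], which drops at each step of
   the climb. *)
move: {2}(#|_|) (leqnn #|[set k | x i < x k]|) => m.
elim: m i => [|m IH] i im; have [il|il] := boolP (i \in leaders (sgn x));
  try by exists i; split=> // y _; rewrite lexx lerDl mulr_ge0.
  move: il; rewrite inE negb_forall => /existsP[k]; rewrite negbK sgn0E.
  move=> /andP[ik _]; move: im; rewrite leqn0 cards_eq0 => /eqP/setP/(_ k).
  by rewrite !inE ik.
move: (il); rewrite inE negb_forall => /existsP[k]; rewrite negbK.
case/andP => sik ski; move: (sik); rewrite sgn0E => ik.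
have lt_card : (#|[set l | (x k < x l)%R]| < #|[set l | (x i < x l)%R]|)%N.
  apply: proper_card; apply/properP; split.
    by apply/fintype.subsetP => l; rewrite !inE; apply: lt_trans.
  by exists k; rewrite !inE ?ltxx.
have [j [jl _ jy]] := IH k (leq_trans lt_card im).
exists j; split=> // y yx.
have /andP[y1 y2] := jy y yx.
have yik : y i < y k by rewrite -sgn0E yx.
have yki : y k - y i < w kM by rewrite -sgnE yx.
rewrite (le_trans (ltW yik) y1) /= (le_trans y2) //.
apply: (@le_trans _ _ (y i + (#|[set l | x k < x l]|.+1)%:R * w kM)).
  by rewrite -natr1; lra.
by rewrite lerD2l ler_wpM2r // ler_nat.
Qed.

Section Cells.
Variable n : nat.

Definition cell (s : {ffun 'I_n * 'I_n * K -> bool}) : set 'rV[R]_n :=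
  [set y | generic (y ord0) /\ sgn (y ord0) = s]%classic.

(** The subspace consists of the vectors constant on the fibres of [rep]; replacing each coordinate
    by that of its leader moves it by a bounded amount. *)
Lemma near_cell (x : 'I_n -> R) :
  near_subspace R n #|leaders (sgn x)| (cell (sgn x)).
Proof.
set s := sgn x; set L := leaders s.
have /choice[rep repP] := leader_chain x.
pose B : 'M[R]_(#|L|, n) := \matrix_(r, i) (rep i == enum_val r)%:R.
exists B; split.
  apply/eqP; rewrite -/(row_free B); apply/row_freeP.
  (* Reading off the leader columns is a right inverse of [B], because [rep] fixes every leader. *)
  exists (\matrix_(i, r) (i == enum_val r)%:R); apply/matrixP => r r'.
  rewrite !mxE (bigD1 (enum_val r')) //= !mxE eqxx mulr1 big1 ?addr0; last first.
    by move=> i /negbTE ir; rewrite !mxE ir mulr0.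
  have [_ /(_ (enum_valP r')) -> _] := repP (enum_val r').
  by rewrite (inj_eq enum_val_inj) eq_sym.
pose M : R := #|'I_n|%:R * w kM.
(* The added 1 keeps the radius positive when [n] or [w kM] is 0. *)
exists (Num.sqrt (\sum_(i < n) M ^+ 2) + 1).
  by rewrite ltr_wpDl // sqrtr_ge0.
move=> y [_ ys]; exists (\row_i y ord0 (rep i)); split.
  apply/submxP; exists (\row_r y ord0 (enum_val r)); apply/rowP => i.
  have [il _ _] := repP i.
  rewrite !mxE (bigD1 (enum_rank_in il (rep i))) //= !mxE enum_rankK_in //.
  rewrite eqxx mulr1 big1 ?addr0 // => r rn; rewrite !mxE.
  case: eqP => [e|_]; last by rewrite mulr0.
  by case/eqP: rn; apply: enum_val_inj; rewrite enum_rankK_in.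
apply: (@le_trans _ _ (Num.sqrt (\sum_(i < n) M ^+ 2))); last by rewrite lerDl.
apply: ler_wsqrtr; apply: ler_sum => i _; rewrite mxE.
have [_ _ /(_ _ ys) yM] := repP i.
by rewrite -real_normK ?num_real // lerXn2r // nnegrE // mulr_ge0.
Qed.

(** The rows of [D] are the directions of [shift_down]. A ray that stays within distance [r] of a
    subspace has its direction in that subspace, so these independent rows all lie in the row space
    of [B]. *)
Lemma near_cell_rank (x : 'I_n -> R) k : generic x ->
  near_subspace R n k (cell (sgn x)) -> (#|leaders (sgn x)| <= k)%N.
Proof.
move=> gx [B [rB [r _ near]]].
set L := leaders (sgn x).
pose D : 'M[R]_(#|L|, n) := \matrix_(j, i) (x i <= x (enum_val j))%R%:R.
suff DB : (D <= B)%MS.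
  suff /eqP <- : row_free D by rewrite -rB; apply: mxrankS.
  apply: inj_row_free => v /rowP vD; apply/rowP => j; rewrite mxE.
  apply/eqP/negPn/negP => vj.
  (* Triangularity: among the leaders with nonzero coefficient, only the one with the largest
     coordinate has a nonzero entry in its own column. *)
  have [m vm mP] := @Order.TotalTheory.arg_maxP _ _ _ j
    (fun j => v ord0 j != 0) (fun j => x (enum_val j)) vj.
  have := vD (enum_val m); rewrite !mxE (bigD1 m) //= mxE lexx mulr1 big1.
    by rewrite addr0 => v0; rewrite v0 eqxx in vm.
  move=> p pm; rewrite mxE; have [-> |/mP pM] := eqVneq (v ord0 p) 0.
    by rewrite mul0r.
  case: leP; rewrite ?mulr0 // => mp.
  case/eqP: pm; apply: enum_val_inj; apply: (generic_inj gx).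
  by apply/le_anti/andP.
apply/row_subP => j; rewrite submxE; set d := row j D; apply/eqP/rowP => c.
rewrite [RHS]mxE; set C := cokermx B.
pose X : 'rV[R]_n := \row_i x i.
(* Since [C] kills the row space of [B], only [X] and an error with entries at most [r] contribute;
   the bound is independent of [t]. *)
pose M : R := `|(X *m C) ord0 c| + \sum_i r * `|C i c|.
have bound t : 0 <= t -> t * `|(d *m C) ord0 c| <= M.
  move=> t0; have [gz sz] := shift_down gx (enum_valP j) t0.
  have [|y [yB yr]] := near (X - t *: d).
    rewrite /cell /mkset.
    have -> : (X - t *: d) ord0 = fun i => x i - t * (x i <= x (enum_val j))%R%:R.
      by apply/funext => i; rewrite !mxE.
    by split.
  set v := X - t *: d - y.
  have vr i : `|v ord0 i| <= r.
    apply: le_trans yr; rewrite -sqrtr_sqr; apply: ler_wsqrtr.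
    rewrite (bigD1 i) //= [v ord0 i]mxE [X in _ + X]mxE lerDl sumr_ge0 // => p _.
    exact: sqr_ge0.
  have yC : y *m C = 0 by apply/eqP; rewrite -submxE.
  have tdE : t *: (d *m C) = X *m C - v *m C.
    by rewrite /v !mulmxBl yC subr0 -scalemxAl opprB addrCA subrr addr0.
  have -> : t * `|(d *m C) ord0 c| = `|(X *m C) ord0 c - (v *m C) ord0 c|.
    have := congr1 (fun A : 'rV[R]_n => A ord0 c) tdE; rewrite !mxE /= => <-.
    by rewrite normrM (ger0_norm t0).
  apply: le_trans (ler_normB _ _) _; rewrite lerD2l mxE.
  apply: le_trans (ler_norm_sum _ _ _) _; apply: ler_sum => i _.
  by rewrite normrM ler_wpM2r.
apply/eqP/negPn/negP => dC; have nd : 0 < `|(d *m C) ord0 c| by rewrite normr_gt0.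
have M0 : 0 <= M by have := bound 0 (lexx 0); rewrite mul0r.
have := bound ((M + 1) / `|(d *m C) ord0 c|).
rewrite divfK ?gt_eqF // => /(_ _); rewrite divr_ge0 ?(addr_ge0 M0) // => /(_ isT).
by rewrite gerDl ler10.
Qed.

Lemma is_level_cell (x : 'I_n -> R) l : generic x ->
  is_level R n l (cell (sgn x)) <-> #|leaders (sgn x)| = l.
Proof.
move=> gx; split=> [[xl lmin]|<-]; last first.
  split=> [|k kl /(near_cell_rank gx)]; first exact: near_cell.
  by rewrite leqNgt kl.
apply/eqP; rewrite eqn_leq near_cell_rank //= leqNgt.
by apply/negP => /lmin; apply; apply: near_cell.
Qed.

(** * Connected components of the complement *)

Definition generic_set : set 'rV[R]_n := [set y | generic (y ord0)]%classic.

(** On a connected set of generic points each coordinate difference takes an interval of values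
    avoiding the thresholds, so signs are constant. Conversely, a segment joins two points of a
    cell. *)
Lemma connected_component_cell (x : 'rV[R]_n) : generic (x ord0) ->
  connected_component generic_set x = cell (sgn (x ord0)).
Proof.
move=> gx; apply/seteqP; split=> [y [C [Cx CU Cc] Cy]|y [gy xy]].
  split; first exact: CU.
  apply/ffunP => -[[i j] k]; rewrite !sgnE.
  have [->|ij] := eqVneq i j; first by rewrite !subrr.
  pose f (z : 'rV[R]_n) := z ord0 i - z ord0 j.
  have cf : continuous f.
    have cc l : continuous (fun z : 'rV[R]_n => z ord0 l).
      exact: coord_continuous.
    by move=> z; exact: (cvgB (cc i z) (cc j z)).
  have /connected_intervalP fI : connected (f @` C)%classic.
    by apply: connected_continuous_connected => //; apply: continuous_subspaceT.
  have fC z : C z -> f z != w k by move=> /CU; apply.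
  rewrite -/(f x) -/(f y).
  have [xk|xk] := ltP (f x) (w k); have [yk|yk] := ltP (f y) (w k) => //.
    have [z Cz fz] : (f @` C)%classic (w k).
      by apply: (fI (f x) (f y)); [exists x|exists y|rewrite (ltW xk)].
    by have := fC z Cz; rewrite fz eqxx.
  have [z Cz fz] : (f @` C)%classic (w k).
    by apply: (fI (f y) (f x)); [exists y|exists x|rewrite (ltW yk)].
  by have := fC z Cz; rewrite fz eqxx.
pose g (t : R) : 'rV[R]_n := x + t *: (y - x).
have cg : continuous g.
  by move=> t; apply: cvgD; [exact: cvg_cst | apply: cvgZr_tmp; exact: cvg_id].
exists (g @` `[0, 1])%classic; last first.
  by exists 1; rewrite /= ?in_itv /= ?ler01 ?lexx // /g scale1r addrC subrK.
split.
- by exists 0; rewrite /= ?in_itv /= ?ler01 ?lexx // /g scale0r addr0.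
- move=> _ [t t01 <-] i j k ij.
  have := gx i j k ij; have := gy i j k ij.
  have := congr1 (fun s : {ffun _} => s (i, j, k)) xy; rewrite !sgnE /g !mxE.
  move: t01; rewrite /= in_itv /= => /andP[t0 t1].
  set a := x ord0 i; set b := x ord0 j; set c := y ord0 i; set d := y ord0 j.
  move=> cdab cd ab.
  have -> : a + t * (c - a) - (b + t * (d - b)) =
    (1 - t) * (a - b) + t * (c - d) by ring.
  by apply: same_side_convex; rewrite ?t0.
- apply: connected_continuous_connected; first exact: segment_connected.
  exact: continuous_subspaceT.
Qed.

Lemma card_cells l :
  #|` fset_set [set X | [set connected_component generic_set x |
        x in generic_set] X /\ is_level R n l X]%classic | = #|Reg 'I_n l|.
Proof.
have [E EP <-] : exists2 E : {fset _}, E =i Reg 'I_n l & #|` E| = #|Reg 'I_n l|.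
  exists (seq_fset tt (enum (Reg 'I_n l))) => [s|]; first by rewrite seq_fsetE mem_enum.
  by rewrite size_seq_fset undup_id ?enum_uniq // -cardE.
have rowK (x : 'I_n -> R) : (\row_i x i : 'rV[R]_n) ord0 = x.
  by apply/funext => i; rewrite mxE.
have -> : [set X | [set connected_component generic_set x |
    x in generic_set] X /\ is_level R n l X]%classic = (cell @` [set` E])%classic.
  apply/seteqP; split=> [_ [[x gx <-]]|_ [s + <-]].
    rewrite connected_component_cell // is_level_cell // => xl.
    by exists (sgn (x ord0)) => //=; rewrite EP Reg_sgn.
  rewrite /= EP => /RegP[x [gx <- xl]]; split; last by rewrite is_level_cell.
  exists (\row_i x i); first by rewrite /generic_set /= rowK.
  by rewrite connected_component_cell rowK.
rewrite fset_set_image ?set_fsetK; last exact: finite_fset.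
apply: card_in_imfset => s s'.
rewrite !EP => /RegP[x [gx <- _]] /RegP[y [gy <- _]] e.
have : cell (sgn y) (\row_i x i) by rewrite -e /cell /mkset rowK.
by case; rewrite rowK.
Qed.

End Cells.
End Signs.

(** * The arrangement and its generating functions *)

Section Arrangement.
Variables (R : realType) (A : seq R).
Hypothesis A_gt0 : all (fun a => 0 < a) A.

Let K : finType := seq_sub (0 :: A).
Let w (k : K) : R := ssval k.
(** The default 0 keeps the maximum inside [0 :: A] when [A] is empty. *)
Let maxA : R := \big[Num.max/0]_(a <- A) a.

Let maxA_in : maxA \in 0 :: A.
Proof.
rewrite /maxA; elim: A => [|a s IH]; first by rewrite big_nil inE eqxx.
rewrite big_cons /Num.max; case: ifP => _; last by rewrite !inE eqxx orbT.
by move: IH; rewrite !inE => /orP[->|->]; rewrite ?orbT.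
Qed.

Let k0 : K := SeqSub (mem_head 0 A).
Let kM : K := SeqSub maxA_in.

Let w0 : w k0 = 0.
Proof. by []. Qed.

Let w_ge0 k : 0 <= w k.
Proof.
case: k => a; rewrite /w /=; rewrite inE => /predU1P[->//|aA].
by apply/ltW/(allP A_gt0).
Qed.

Let w_leM k : w k <= w kM.
Proof.
case: k => a; rewrite /w /=; rewrite inE => /predU1P[->|aA].
  by rewrite /maxA; apply: bigmax_ge_id.
by rewrite /maxA; apply: le_bigmax_seq.
Qed.

Lemma setC_CnA_union n :
  (~` CnA_union R A n)%classic = @generic_set R K w n.
Proof.
apply/seteqP; split=> x.
  move=> xU i j [a aA] /= ij; apply/eqP => xa; apply: xU.
  move: aA xa; rewrite inE => /predU1P[->|aA] xa; last first.
    by right; exists i, j, a.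
  left; move: ij; rewrite neq_ltn => /orP[ij|ji]; first by exists i, j.
  by exists j, i; split=> //; rewrite -opprB xa oppr0.
move=> gx [[i [j [ij xij]]]|[i [j [a aA [ij xij]]]]].
  have ij' : i != j by rewrite neq_ltn ij.
  by have := gx i j k0 ij'; rewrite xij eqxx.
have aA' : a \in 0 :: A by rewrite inE aA orbT.
by have := gx i j (SeqSub aA') ij; rewrite xij eqxx.
Qed.

Lemma r_levelE l n : r_level R A l n = #|Reg w k0 kM 'I_n l|.
Proof.
by rewrite /r_level /regions setC_CnA_union (card_cells w0 w_ge0 w_leM).
Qed.

Lemma r_level_rec l n : r_level R A l.+1 n =
  (\sum_(k < n.+1) 'C(n, k) * (r_level R A 1 k * r_level R A l (n - k)))%N.
Proof.
rewrite r_levelE (card_Reg_rec w0 w_ge0 w_leM).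
by apply: eq_bigr => k _; rewrite !r_levelE.
Qed.

Lemma r_level0 n : r_level R A 0 n = (n == 0)%N.
Proof. by rewrite r_levelE card_Reg0. Qed.

(** Dividing by factorials turns the binomial convolution of [r_level_rec] into the product of
    generating functions. *)
Lemma F_trunc_rec l N :
  F_trunc R A l.+1 N = take_poly N.+1 (F_trunc R A 1 N * F_trunc R A l N).
Proof.
apply/polyP => n; rewrite coef_take_poly coef_poly; case: ltnP => // nN.
rewrite coefM r_level_rec natr_sum mulr_suml; apply: eq_bigr => -[k kn] _ /=.
rewrite ltnS in kn; rewrite !coef_poly.
rewrite (leq_ltn_trans kn nN) (leq_ltn_trans (leq_subr k n) nN).
have := congr1 (fun m => m%:R : R) (bin_fact kn); rewrite !natrM => <-.
have f0 m : m`!%:R != 0 :> R by rewrite pnatr_eq0 -lt0n fact_gt0.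
field; rewrite !f0 /= pnatr_eq0 -lt0n bin_gt0 kn //.
Qed.

End Arrangement.

(* Equality of formal power series F_l = (F_1)^l, stated as equality of all
   truncations modulo t^(N+1). *)
Theorem theorem1p2 (R : realType) (A : seq R) (hA : all (fun a => 0 < a) A)
  (l : nat) :
  forall N : nat, F_trunc R A l N = take_poly N.+1 (F_trunc R A 1 N ^+ l).
Proof.
move=> N; elim: l => [|l IH].
  rewrite expr0; apply/polyP => n; rewrite coef_take_poly coef_poly coef1 r_level0 //.
  by case: ltnP => // _; case: n => [|n]; rewrite ?divr1 ?mul0r.
(* Truncating the power first is harmless: a coefficient of index at most [N] of a product uses only
   coefficients of index at most [N] of the factors. *)
rewrite F_trunc_rec // IH exprS; apply/polyP => n; rewrite !coef_take_poly.
case: ltnP => // nN; rewrite !coefM; apply: eq_bigr => k _.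
by rewrite coef_take_poly (leq_ltn_trans (leq_subr k n) nN).
Qed.
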